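(* Let $\lambda^*>0$ and let $Y_1,Y_2,\dots$ be i.i.d. $\mathrm{Pois}(\lambda^* )$, so that $\boldsymbol{Y}^{(n)}=(Y_1,\dots,Y_n)$ has law $\mathrm{Pois}(\lambda^* )^{\otimes n}$. For each $\theta>0$ consider the model in which $Y_1,\dots,Y_n\mid\omega$ are i.i.d. $\mathrm{Pois}(\omega\theta)$ and $\omega\sim\mathrm{Gamma}(1,1)$, with marginal likelihood $\pi(\boldsymbol{Y}^{(n)};\theta)$ and Laplace approximate marginal likelihood $\widetilde\pi_{\mathrm{LA}}(\boldsymbol{Y}^{(n)};\theta)$ as defined in the context. Then, almost surely, there exists $N_0$ such that for all $n>N_0$, $$\inf_{\theta>0}\left|\frac{\pi(\boldsymbol{Y}^{(n)};\theta)}{\widetilde\pi_{\mathrm{LA}}(\boldsymbol{Y}^{(n)};\theta)}-1\right|\ge\frac{1}{26\,n\,\lambda^*}.$$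
   Context: $\mathrm{Gamma}(1,1)$ has density $e^{-\omega}$ on $(0,\infty)$. For $\theta>0$ the joint density is $$\pi(\boldsymbol{Y}^{(n)},\omega;\theta)=e^{-\omega}\prod_{i=1}^n\frac{(\omega\theta)^{Y_i}e^{-\omega\theta}}{Y_i!},\qquad\omega>0,$$ and the marginal likelihood is $\pi(\boldsymbol{Y}^{(n)};\theta)=\int_0^\infty\pi(\boldsymbol{Y}^{(n)},\omega;\theta)\,d\omega$. Let $\hat\omega_n^\theta=\operatorname{argmax}_{\omega>0}\pi(\boldsymbol{Y}^{(n)},\omega;\theta)$ and $\hat H_n^\theta=-\frac{d^2}{d\omega^2}\log\pi(\boldsymbol{Y}^{(n)},\omega;\theta)\big|_{\omega=\hat\omega_n^\theta}$ (well defined whenever $\sum_{i=1}^nY_i>0$, which holds almost surely for all large enough $n$). The Laplace approximate marginal likelihood is $\widetilde\pi_{\mathrm{LA}}(\boldsymbol{Y}^{(n)};\theta)=(2\pi)^{1/2}\,(\hat H_n^\theta)^{-1/2}\,\pi(\boldsymbol{Y}^{(n)},\hat\omega_n^\theta;\theta)$, where the $\pi$ in $(2\pi)^{1/2}$ is the numerical constant. *)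

(* Defs.v *)
From HB Require Import structures.
From mathcomp Require Import all_boot all_order all_algebra.
From mathcomp Require Import all_classical all_reals all_analysis.

Set Implicit Arguments.
Unset Strict Implicit.
Unset Printing Implicit Defensive.

Import Order.TTheory GRing.Theory Num.Theory.
Import numFieldNormedType.Exports.

Local Open Scope classical_set_scope.
Local Open Scope ring_scope.

Section independence.
Context d d' (T : measurableType d) (T' : measurableType d') (R : realType).
Variable P : probability T R.

(* Mutual independence: the product rule over every finite subfamily, a
   subfamily being given by a duplicate-free list of its indices. *)
Definition mutually_independent (I : choiceType) (X : I -> {RV P >-> T'}) :=
  forall (J : seq I) (A : I -> set T'), uniq J ->
    (forall i, measurable (A i)) ->
    (P (\bigcap_(i in [set` J]) (X i @^-1` A i))
       = \prod_(i <- J) P (X i @^-1` A i))%E.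

End independence.

(* The [nat] argument of the library's [poisson_prob] is a dummy: it does not
   occur in the body of the definition, so its value [0] is irrelevant. *)
Definition iid_poisson d (T : measurableType d) (R : realType)
    (P : probability T R) (rate : R) (Y : nat -> {RV P >-> nat}) : Prop :=
  mutually_independent Y /\
  forall i (A : set nat), distribution P (Y i) A = poisson_prob rate 0 A.

(* Some maximizer of [f] over [D]; the junk value [0] if there is none. *)
Definition argmax_on (R : realType) (D : set R) (f : R -> R) : R :=
  xget 0 [set x | D x /\ forall z, D z -> f z <= f x].

Section laplace.
Context (R : realType) (n : nat).
Variables (y : 'I_n -> nat) (theta : R).

Definition joint_density (omega : R) : R :=
  expR (- omega) *
  \prod_(i < n) ((omega * theta) ^+ y i * expR (- (omega * theta))
                 / (y i)`!%:R).

(* For [0 < theta] the integrand lies between [0] and [expR (- omega)], so the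
   integral is finite and the real-valued integral is the intended one. *)
Definition marginal_likelihood : R :=
  \int[lebesgue_measure]_(omega in [set omega : R | 0 < omega])
    joint_density omega.

(* For [0 < theta] the maximizer exists iff some [y i] is positive, and it is
   then unique. *)
Definition omega_hat : R :=
  argmax_on [set omega : R | 0 < omega] joint_density.

Definition hessian_hat : R :=
  - derive1n 2 (fun omega : R => ln (joint_density omega)) omega_hat.

Definition laplace_marginal : R :=
  Num.sqrt (2 * pi) * (Num.sqrt hessian_hat)^-1 * joint_density omega_hat.

End laplace.

(* Main.v *)
Require Import Defs.
From HB Require Import structures.
From mathcomp Require Import all_boot all_order all_algebra.
From mathcomp Require Import all_classical all_reals all_analysis.
From mathcomp Require Import measurable_realfun.
From mathcomp Require Import ring lra.

Set Implicit Arguments.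
Unset Strict Implicit.
Unset Printing Implicit Defensive.

Import Order.TTheory GRing.Theory Num.Theory.
Import numFieldNormedType.Exports.

Local Open Scope classical_set_scope.
Local Open Scope ring_scope.

(** Write [S] for the sum of the [n] observations.  As a function of [omega],
    the joint density is a constant multiple of the Gamma kernel
    [omega ^ S * exp (- a omega)] with [a = 1 + n theta].  Everything can then
    be computed: the marginal likelihood is the constant times
    [S! / a ^ (S + 1)], the maximizer is [S / a], and the curvature there is
    [a ^ 2 / S].  In the quotient of the marginal likelihood by its Laplace
    approximation all powers of [a] cancel, so [theta] disappears
    ([laplace_ratioE]): what remains is the quotient of [S!] by Stirling's
    approximation [sqrt (2 pi S) * S ^ S * exp (- S)].  The relative error of
    the Laplace approximation is the relative error of Stirling's formula,
    uniformly in [theta].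

    That error is at least [1 / (12 S + 1)] (Robbins, [stirling_ratio_ge]).
    The logarithm of [n! / (sqrt n * (n / e) ^ n)] decreases in [n], by steps at
    least as large as those of [1 / (12 n + 1)], so it exceeds its limit by at
    least [1 / (12 n + 1)].  The limit is bounded below by [ln (2 pi) / 2] with
    Wallis' integrals of powers of the sine ([wallis_bound]).

    It remains to bound [S] from above.  A sum of [n] independent Poisson
    variables of rate [lambda] is Poisson of rate [n lambda]
    ([partial_sum_poisson]), so the events [2 n lambda < S] and [S = 0] have
    probabilities that decrease geometrically in [n], and by Borel-Cantelli
    almost surely [0 < S <= 2 n lambda] for all large [n]
    ([partial_sum_eventually]).  Then [12 S + 1 <= 24 n lambda + 1], which is
    at most [26 n lambda] once [1 <= 2 n lambda]. *)

(** * Wallis' integrals *)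

Section wallis.
Context {R : realType}.
Local Notation mu := (@lebesgue_measure R).
Implicit Types (F f : R -> R) (a b x : R) (n : nat).

Lemma Rintegral_is_derive F f a b : a < b -> continuous f ->
  (forall x, is_derive x 1 F (f x)) ->
  \int[mu]_(x in `[a, b]) f x = F b - F a.
Proof.
move=> ab cf dF; rewrite /Rintegral (@continuous_FTC2 R f F)//.
- exact: continuous_subspaceT.
- have cF : continuous F.
    move=> x; apply/differentiable_continuous/derivable1_diffP.
    exact: (@ex_derive _ _ _ _ _ _ _ (dF x)).
  split.
  + by move=> x _; exact: (@ex_derive _ _ _ _ _ _ _ (dF x)).
  + by apply: cvg_at_right_filter; exact: cF.
  + by apply: cvg_at_left_filter; exact: cF.
- by move=> x _; rewrite derive1E (@derive_val _ _ _ _ _ _ _ (dF x)).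
Qed.

Definition wallis_integral n : R := \int[mu]_(x in `[0, pi]) sin x ^+ n.

Let sinX_cont n : continuous (fun x : R => sin x ^+ n).
Proof.
move=> x; apply: (@continuous_comp _ _ _ sin (fun y => y ^+ n)).
  exact: continuous_sin.
exact: exprn_continuous.
Qed.

Let sinX_int n : mu.-integrable `[0, pi] (EFin \o (fun x : R => sin x ^+ n)).
Proof.
apply: continuous_compact_integrable; first exact: segment_compact.
exact: continuous_subspaceT.
Qed.

Lemma wallis_integral0 : wallis_integral 0 = pi.
Proof.
by rewrite /wallis_integral (@Rintegral_is_derive id) ?subr0 ?pi_gt0.
Qed.

Lemma wallis_integral1 : wallis_integral 1 = 2.
Proof.
have dcos x : is_derive x 1 (- (@cos R)) (sin x ^+ 1).
  by apply: is_derive_eq; rewrite opprK expr1.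
rewrite /wallis_integral (Rintegral_is_derive (pi_gt0 R) _ dcos)//.
by rewrite !opprfctE cospi cos0; ring.
Qed.

(** Integrating the derivative of [sin ^ (n + 1) * cos], which vanishes at both
    ends of [[0, pi]]. *)
Lemma wallis_integral_rec n :
  n.+2%:R * wallis_integral n.+2 = n.+1%:R * wallis_integral n.
Proof.
pose f x : R := n.+1%:R * sin x ^+ n - n.+2%:R * sin x ^+ n.+2.
have cf : continuous f.
  by move=> x; apply: cvgB; apply: cvgMl_tmp; exact: sinX_cont.
have df x : is_derive x 1 (sin ^+ n.+1 * cos) (f x).
  apply: is_derive_eq.
  rewrite /f /GRing.scale/= exprfctE.
  have -> : sin x ^+ n.+2 = sin x ^+ n * sin x ^+ 2 by rewrite -exprD addn2.
  rewrite [sin x ^+ n.+1]exprSr -[n.+2%:R]natr1.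
  have : cos x ^+ 2 = 1 - sin x ^+ 2 by rewrite cos2sin2.
  move: (sin x ^+ n) => s.
  rewrite !expr2 => cs.
  rewrite (_ : cos x * _ = n.+1%:R * s * (cos x * cos x)); last by ring.
  by rewrite cs; ring.
have := Rintegral_is_derive (pi_gt0 R) cf df.
rewrite /f RintegralB//=; last 2 first.
  exact: (integrableZl _ _ (sinX_int n)).
  exact: (integrableZl _ _ (sinX_int n.+2)).
rewrite !RintegralZl// -!/(wallis_integral _) => H.
apply/esym/eqP; rewrite -subr_eq0 H.
by rewrite !mulrfctE !exprfctE sin0 sinpi !expr0n/= !mul0r subrr.
Qed.

Lemma wallis_integral_nonincreasing n :
  wallis_integral n.+1 <= wallis_integral n.
Proof.
apply: le_Rintegral => //= x; rewrite in_itv/= => x0pi.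
by rewrite exprS ler_piMl ?sin_le1// exprn_ge0// sin_ge0_pi.
Qed.

(** The recurrence says that the left-hand side does not depend on [n]. *)
Lemma wallis_integral_mulS n :
  n.+1%:R * (wallis_integral n.+1 * wallis_integral n) = 2 * pi.
Proof.
elim: n => [|n IHn]; first by rewrite wallis_integral0 wallis_integral1 mul1r.
by rewrite -IHn mulrA wallis_integral_rec; ring.
Qed.

Lemma wallis_integral_even n :
  wallis_integral n.*2 * (4 ^+ n * n`!%:R ^+ 2) = pi * (n.*2)`!%:R.
Proof.
elim: n => [|n IHn]; first by
  rewrite wallis_integral0 expr0 !fact0 expr1n !mulr1.
have /= := wallis_integral_rec n.*2; rewrite doubleS => rec.
rewrite !factS !natrM exprS.
have e1 : n.*2.+1%:R = 2 * n%:R + 1 :> R by rewrite -natr1 -muln2 natrM mulrC.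
have e2 : n.*2.+2%:R = 2 * n%:R + 2 :> R by rewrite -natr1 e1; ring.
rewrite e1 e2 in rec *; rewrite -[n.+1%:R]natr1.
rewrite [RHS](_ : _ = (2 * n%:R + 2) * ((2 * n%:R + 1) *
  (pi * (n.*2)`!%:R))); last by ring.
rewrite -IHn [RHS](_ : _ = (2 * n%:R + 2) * (4 ^+ n * n`!%:R ^+ 2)
 * ((2 * n%:R + 1) * wallis_integral n.*2)); last by ring.
by rewrite -rec; ring.
Qed.

(** The half of Wallis' asymptotics for the central binomial coefficient that
    follows from [w (2 n) ^ 2 <= w (2 n) * w (2 n - 1) = pi / n] for the
    integrals [w]. *)
Lemma wallis_bound n :
  n%:R * pi * (n.*2)`!%:R ^+ 2 <= 16 ^+ n * n`!%:R ^+ 4 :> R.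
Proof.
case: n => [|n]; first by rewrite !mul0r mulr_ge0.
have wE := wallis_integral_even n.+1.
have wM := wallis_integral_mulS n.*2.+1.
have wL := wallis_integral_nonincreasing n.*2.+1.
rewrite -doubleS in wE wM wL.
set w := wallis_integral n.+1.*2 in wE wM wL.
set v := wallis_integral _ in wM wL.
have w0 : 0 <= w.
  apply: Rintegral_ge0 => x /=; rewrite in_itv/= => /sin_ge0_pi.
  exact: exprn_ge0.
have pi0 : 0 < pi :> R := pi_gt0 R.
set K := 4 ^+ n.+1 * _ in wE.
have -> : 16 ^+ n.+1 * n.+1`!%:R ^+ 4 = K ^+ 2 :> R.
  rewrite (_ : 16 = 4 ^+ 2); last by ring.
  by rewrite /K [in RHS]exprMn -!exprM [(n.+1 * 2)%N]mulnC.
rewrite -(ler_pM2l pi0).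
have -> : (pi : R) * (n.+1%:R * pi * (n.+1.*2)`!%:R ^+ 2) =
    n.+1%:R * w ^+ 2 * K ^+ 2.
  transitivity (n.+1%:R * (pi * (n.+1.*2)`!%:R) ^+ 2 : R); first by ring.
  by rewrite -wE; ring.
apply: ler_wpM2r; first exact: sqr_ge0.
have : n.+1.*2%:R = 2 * n.+1%:R :> R by rewrite -muln2 natrM mulrC.
move=> nE; rewrite nE in wM.
have : n.+1%:R * (w * w) <= n.+1%:R * (w * v) :> R.
  by rewrite ler_wpM2l// ler_wpM2l.
rewrite expr2; lra.
Qed.

End wallis.

(** * Stirling's formula with a lower bound on the error *)

Section stirling.
Context {R : realType}.
Implicit Types (x u : R) (n : nat).

Lemma is_derive_nondecreasing (f df : R -> R) a b : a <= b ->
  (forall x, x \in `[a, b] -> is_derive x 1 f (df x)) ->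
  (forall x, x \in `]a, b[ -> 0 <= df x) -> f a <= f b.
Proof.
move=> ab dfE df0; move: (ab); rewrite le_eqVlt => /predU1P[->//|ab'].
have cf : {within `[a, b], continuous f}.
  apply: derivable_within_continuous => x xab.
  exact: (@ex_derive _ _ _ _ _ _ _ (dfE _ xab)).
have dfE' x : x \in `]a, b[ -> is_derive x 1 f (df x).
  by move=> xab; apply: dfE; apply: subset_itv_oo_cc xab.
have [c cab fbfa] := MVT ab' dfE' cf.
by rewrite -subr_ge0 fbfa mulr_ge0 ?df0// subr_ge0.
Qed.

Let is_derive_1D x : is_derive x 1 (fun y : R => 1 + y) 1.
Proof. by apply: is_derive_eq; rewrite /GRing.scale/=; ring. Qed.

Let is_derive_1B x : is_derive x 1 (fun y : R => 1 - y) (- 1).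
Proof. by apply: is_derive_eq; rewrite /GRing.scale/=; ring. Qed.

Let is_derive_ln1D x : -1 < x ->
  is_derive x 1 (fun y : R => ln (1 + y)) (1 + x)^-1.
Proof.
move=> x1; have x0 : 0 < 1 + x by lra.
have dln := is_derive1_ln x0.
have := is_derive1_comp (g := fun y => 1 + y) dln (is_derive_1D x).
by rewrite mulr1.
Qed.

Let is_derive_ln1B x : x < 1 ->
  is_derive x 1 (fun y : R => ln (1 - y)) (- (1 - x)^-1).
Proof.
move=> x1; have x0 : 0 < 1 - x by lra.
have dln := is_derive1_ln x0.
have := is_derive1_comp (g := fun y => 1 - y) dln (is_derive_1B x).
by rewrite mulrN1.
Qed.

(** The bound is the beginning of the power series of the difference of
    logarithms, whose coefficients are nonnegative. *)
Lemma ln_ratio_ge u : 0 <= u < 1 ->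
  2 * u + 2 / 3 * u ^+ 3 <= ln (1 + u) - ln (1 - u).
Proof.
move=> /andP[u0 u1].
pose f x := ln (1 + x) - ln (1 - x) - (2 * x + 2 / 3 * x ^+ 3).
pose df x := (1 + x)^-1 + (1 - x)^-1 - (2 + 2 * x ^+ 2).
suff : f 0 <= f u by rewrite /f addr0 subr0 ln1; lra.
apply: (@is_derive_nondecreasing f df) => // x;
  rewrite in_itv/= => /andP[x0 x1].
  have := @is_derive_ln1D x; have := @is_derive_ln1B x => dB dD.
  have {}dB := dB ltac:(lra); have {}dD := dD ltac:(lra).
  apply: is_derive_eq; rewrite /df /GRing.scale/=; field.
  by apply/andP; split; lra.
rewrite /df (_ : _ - _ = 2 * x ^+ 4 / ((1 + x) * (1 - x))); last first.
  by field; apply/andP; split; lra.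
by rewrite divr_ge0// ?mulr_ge0// ?exprn_ge0//; lra.
Qed.

Lemma ln_ratio_le u : 0 <= u < 1 ->
  ln (1 + u) - ln (1 - u) <= 2 * u / (1 - u ^+ 2).
Proof.
move=> /andP[u0 u1].
(* Partial fractions: the bound is [1 / (1 - u) - 1 / (1 + u)]. *)
pose f x := (1 - x)^-1 - (1 + x)^-1 - (ln (1 + x) - ln (1 - x)).
pose df x := (1 - x) ^- 2 + (1 + x) ^- 2 - ((1 + x)^-1 + (1 - x)^-1).
have -> : 2 * u / (1 - u ^+ 2) = (1 - u)^-1 - (1 + u)^-1.
  by field; repeat (apply/andP; split); nra.
suff : f 0 <= f u by rewrite /f addr0 subr0 ln1; lra.
apply: (@is_derive_nondecreasing f df) => // x;
  rewrite in_itv/= => /andP[x0 x1].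
  have := @is_derive_ln1D x; have := @is_derive_ln1B x => dB dD.
  have {}dB := dB ltac:(lra); have {}dD := dD ltac:(lra).
  have nB : 1 - x != 0 by lra.
  have nD : 1 + x != 0 by lra.
  have dB' : is_derive x 1 (fun y : R => (1 - y)^-1) ((1 - x) ^- 2).
    have := is_deriveV (f := fun y => 1 - y) nB (is_derive_1B x) => d1V.
    apply: (is_derive_eq d1V).
    by rewrite /GRing.scale/= mulrN1 opprK.
  have dD' : is_derive x 1 (fun y : R => (1 + y)^-1) (- (1 + x) ^- 2).
    have := is_deriveV (f := fun y => 1 + y) nD (is_derive_1D x) => d1V.
    apply: (is_derive_eq d1V).
    by rewrite /GRing.scale/= mulr1.
  by apply: is_derive_eq; rewrite /df; lra.
have -> : df x = 4 * x ^+ 2 / ((1 + x) * (1 - x)) ^+ 2.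
  by rewrite /df; field; apply/andP; split; lra.
by rewrite divr_ge0// ?mulr_ge0// ?exprn_ge0//; nra.
Qed.

(** The logarithm of [n! / (sqrt n * (n / e) ^ n)], which tends to
    [ln (sqrt (2 pi))]. *)
Definition stirling_log n : R :=
  ln n`!%:R - (n%:R + 2^-1) * ln n%:R + n%:R.

Let pos_nat n : (0 < n)%N -> (n%:R : R) \is Num.pos.
Proof. by move=> n0; rewrite posrE ltr0n. Qed.

(** Robbins' substitution: [(n + 1) / n = (1 + u) / (1 - u)], which makes the
    odd part of the logarithm's series appear. *)
Let stirling_logB n (u : R := (2 * n%:R + 1)^-1) : (0 < n)%N ->
  [/\ 0 < u, u < 1 &
  stirling_log n - stirling_log n.+1 =
    (ln (1 + u) - ln (1 - u)) / (2 * u) - 1].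
Proof.
move=> n0; have n0R : 1 <= n%:R :> R by rewrite ler1n.
have u0 : 0 < u by rewrite invr_gt0; lra.
have u1 : u < 1 by rewrite invf_lt1; lra.
split => //.
have -> : 1 + u = 2 * u * n.+1%:R by rewrite /u -natr1; field; lra.
have -> : 1 - u = 2 * u * n%:R by rewrite /u; field; lra.
rewrite !lnM ?pos_nat ?posrE//; try lra.
rewrite /stirling_log factS natrM lnM ?pos_nat ?fact_gt0//.
have -> : 2 * u = (n%:R + 2^-1)^-1 by rewrite /u; field; lra.
by rewrite invrK; move: (ln n.+1%:R) => l; rewrite -[n.+1%:R]natr1; lra.
Qed.

(** The cubic term in [ln_ratio_ge] gives [1 / (3 (2 n + 1) ^ 2)].  The
    telescoping bound with [12 n + 1] is just below it, whereas one with [12 n]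
    would exceed it. *)
Lemma stirling_log_step_ge n : (0 < n)%N ->
  (12 * n%:R + 1)^-1 - (12 * n.+1%:R + 1)^-1 <=
  stirling_log n - stirling_log n.+1.
Proof.
move=> n0; have n0R : 1 <= n%:R :> R by rewrite ler1n.
have [u0 u1 ->] := stirling_logB n0; set u := _^-1 in u0 u1 *.
have : u ^+ 2 / 3 <= (ln (1 + u) - ln (1 - u)) / (2 * u) - 1.
  rewrite lerBrDr ler_pdivlMr; last lra.
  have := @ln_ratio_ge u; rewrite (ltW u0) u1 => /(_ isT).
  by apply: le_trans; rewrite le_eqVlt; apply/orP; left; apply/eqP; field.
apply: le_trans; rewrite -[n.+1%:R]natr1.
have -> : (12 * n%:R + 1)^-1 - (12 * (n%:R + 1) + 1)^-1 =
  12 / ((12 * n%:R + 1) * (12 * n%:R + 13)) :> R.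
  by field; apply/andP; split; lra.
have -> : u ^+ 2 / 3 = 1 / (3 * (2 * n%:R + 1) ^+ 2) by rewrite /u; field; lra.
rewrite ler_pdivrMr; last nra.
rewrite mulrAC ler_pdivlMr; nra.
Qed.

(** Steps dominated by a telescoping sequence keep [stirling_log] bounded
    below, hence convergent. *)
Lemma stirling_log_step_le n : (0 < n)%N ->
  stirling_log n - stirling_log n.+1 <= n%:R^-1 - n.+1%:R^-1.
Proof.
move=> n0; have n0R : 1 <= n%:R :> R by rewrite ler1n.
have [u0 u1 ->] := stirling_logB n0; set u := _^-1 in u0 u1 *.
have : (ln (1 + u) - ln (1 - u)) / (2 * u) - 1 <= (1 - u ^+ 2)^-1 - 1.
  rewrite lerD2r ler_pdivrMr; last lra.
  have := @ln_ratio_le u; rewrite (ltW u0) u1 => /(_ isT).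
  by rewrite mulrC.
move=> /le_trans; apply; rewrite -[n.+1%:R]natr1.
have -> : (1 - u ^+ 2)^-1 - 1 = (4 * (n%:R * (n%:R + 1)))^-1.
  by rewrite /u; field; repeat (apply/andP; split); nra.
have -> : n%:R^-1 - (n%:R + 1)^-1 = (n%:R * (n%:R + 1))^-1 :> R.
  by field; apply/andP; split; lra.
rewrite lef_pV2 ?posrE; nra.
Qed.

(** Wallis' bound in logarithmic form.  At a limit [l] of [stirling_log] it
    reads [ln (2 pi) <= 4 l - 2 l]. *)
Lemma stirling_log_double n : (0 < n)%N ->
  ln (2 * pi) <= 4 * stirling_log n - 2 * stirling_log n.*2.
Proof.
move=> n0; have n0R : 1 <= n%:R :> R by rewrite ler1n.
have pi0 : 0 < pi :> R := pi_gt0 R.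
have f0 k : 0 < k`!%:R :> R by rewrite ltr0n fact_gt0.
have p2 : 0 < 2 :> R by [].
have n0' : 0 < n%:R :> R by rewrite ltr0n.
have l16 : ln 16 = 4 * ln 2 :> R.
  rewrite (_ : 16 = 2 ^+ 4 :> R); last by ring.
  by rewrite lnXn// mulr_natl.
have p16 : 0 < 16 :> R by [].
have := @wallis_bound R n.
move: (f0 n) (f0 n.*2); rewrite /stirling_log.
have -> : n.*2%:R = 2 * n%:R :> R by rewrite -muln2 natrM mulrC.
move: (16 : R) l16 p16 => s l16 s0.
move: (n`!%:R : R) ((n.*2)`!%:R : R) => f g fp gp.
rewrite -ler_ln ?posrE ?mulr_gt0 ?exprn_gt0// => H.
rewrite !lnM ?posrE ?mulr_gt0 ?exprn_gt0// in H *.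
rewrite (lnXn n s0) -[ln s *+ n]mulr_natl l16 in H.
move: H.
move: (ln n%:R) (ln 2) (ln pi) (ln f) (ln g).
move: (n%:R : R) {n0R n0'} => N a b c d e.
lra.
Qed.

(** Subtracting [1 / (12 n + 1)] leaves a nonincreasing sequence with the same
    limit, so each of its terms is at least [ln (2 pi) / 2]. *)
Lemma stirling_log_ge n : (0 < n)%N ->
  ln (2 * pi) / 2 + (12 * n%:R + 1)^-1 <= stirling_log n.
Proof.
pose z k : R := stirling_log k.+1 - (12 * k.+1%:R + 1)^-1.
pose y k : R := stirling_log k.+1 - k.+1%:R^-1.
have zS k : z k.+1 <= z k.
  have := @stirling_log_step_ge k.+1 isT; rewrite /z.
  by move: (_ + 1)^-1 (_ + 1)^-1 => p q; lra.
have yS k : y k <= y k.+1.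
  have := @stirling_log_step_le k.+1 isT; rewrite /y.
  by move: _^-1 _^-1 => p q; lra.
have zd : {homo z : n m / (n <= m)%N >-> m <= n}.
  by apply/nonincreasing_seqP.
have yi : {homo y : n m / (n <= m)%N >-> n <= m}.
  by apply/nondecreasing_seqP.
have yz k : y k <= z k.
  have r1 : 1 <= k.+1%:R :> R by rewrite ler1n.
  rewrite /y /z lerD2l lerN2 lef_pV2 ?posrE;
    by move: (k.+1%:R : R) r1 => r; lra.
have cz : cvgn z.
  apply: nonincreasing_is_cvgn => //; exists (y 0%N) => _ [k _ <-].
  by apply: le_trans (yz k); exact: yi.
have zl := nonincreasing_cvgn_ge zd cz.
suff l2 : ln (2 * pi) / 2 <= limn z.
  case: n => // n _; have := zl n; rewrite /z; lra.
(* [stirling_log_double] in terms of [z]: the limit bounds the term of index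
   [2 (j + 1)], and [z] differs from [stirling_log] by at most [1 / (j + 1)]. *)
have H j : ln (2 * pi) <= 4 * z j - 2 * limn z + 4 * j.+1%:R^-1.
  have := @stirling_log_double j.+1 isT.
  have := zl (j.+1.*2.-1); rewrite /z.
  have -> : j.+1.*2.-1.+1 = j.+1.*2 by [].
  have : (12 * j.+1%:R + 1)^-1 <= j.+1%:R^-1 :> R.
    have r1 : 1 <= j.+1%:R :> R by rewrite ler1n.
    by rewrite lef_pV2 ?posrE; move: (j.+1%:R : R) r1 => r; lra.
  have : 0 <= (12 * (j.+1.*2)%:R + 1)^-1 :> R.
    by rewrite invr_ge0 addr_ge0// mulr_ge0.
  move: (_^-1) => p p0; move: (_ + 1)^-1 (j.+1%:R^-1 : R) => q r.
  lra.
have C : 4 * z k - 2 * limn z + 4 * k.+1%:R^-1 @[k --> \oo] -->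
    4 * limn z - 2 * limn z + 4 * 0.
  apply: cvgD; last by apply: cvgMl_tmp; exact: cvg_harmonic.
  by apply: cvgB; [apply: cvgMl_tmp|exact: cvg_cst].
have : ln (2 * pi) <= 4 * limn z - 2 * limn z + 4 * 0.
  rewrite -(cvg_lim _ C)//; apply: limr_ge.
    by apply/cvg_ex; eexists; exact: C.
  exact: nearW.
lra.
Qed.

Lemma stirling_ratio_ge n : (0 < n)%N ->
  1 + (12 * n%:R + 1)^-1 <=
  n`!%:R / (Num.sqrt (2 * pi) * Num.sqrt n%:R * n%:R ^+ n * expR (- n%:R)) :> R.
Proof.
move=> n0; have n0R : 0 < n%:R :> R by rewrite ltr0n.
have pi0 : 0 < pi :> R := pi_gt0 R.
apply: le_trans (expR_ge1Dx _) _.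
have f0 : 0 < n`!%:R :> R by rewrite ltr0n fact_gt0.
rewrite -ler_ln ?posrE ?expR_gt0//; last first.
  by rewrite divr_gt0// !mulr_gt0 ?expR_gt0 ?exprn_gt0 ?sqrtr_gt0// mulr_gt0.
have half (x : R) : 0 < x -> ln (Num.sqrt x) = ln x / 2.
  move=> x0; rewrite -{2}(sqr_sqrtr (ltW x0)) lnXn ?sqrtr_gt0//.
  by rewrite -[_ *+ 2]mulr_natr mulfK.
rewrite expRK ln_div ?posrE//; last first.
  by rewrite !mulr_gt0 ?expR_gt0 ?exprn_gt0 ?sqrtr_gt0// mulr_gt0.
rewrite !lnM ?posrE ?mulr_gt0 ?expR_gt0 ?exprn_gt0 ?sqrtr_gt0 ?mulr_gt0//.
rewrite !half ?mulr_gt0// expRK lnXn// -[ln _ *+ n]mulr_natl.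
have := stirling_log_ge n0; rewrite /stirling_log.
rewrite lnM ?posrE//; move: (_ + 1)^-1 => p; lra.
Qed.

End stirling.

(** * The Gamma kernel *)

Section gamma_integral.
Context {R : realType}.
Implicit Types (a x : R) (k : nat).

(** From [1 + t <= exp t] at [t = a x / (k + 1)], raised to the power [k + 1],
    the exponential dominates a multiple of [x ^ (k + 1)]. *)
Lemma cvg_exprn_expRN k a : 0 < a ->
  x ^+ k * expR (- (a * x)) @[x --> +oo] --> 0.
Proof.
move=> a0; pose c : R := (k.+1%:R / a) ^+ k.+1.
have c0 : 0 < c by rewrite exprn_gt0// divr_gt0.
apply/cvgrPdist_le => /= e e0; near=> x.
have x0 : 0 < x by near: x; exact: nbhs_pinfty_gt.
have cx : c / e <= x by near: x; apply: nbhs_pinfty_ge; exact: num_real.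
rewrite sub0r normrN ger0_norm ?mulr_ge0 ?expR_ge0 ?exprn_ge0 ?(ltW x0)//.
rewrite expRN ler_pdivrMr ?expR_gt0//.
have q0 : 0 < a * x / k.+1%:R by rewrite divr_gt0 ?mulr_gt0.
have : (a * x / k.+1%:R) ^+ k.+1 <= expR (a * x).
  rewrite -[X in expR X](@divfK _ (k.+1%:R : R))// expRM_natr.
  apply: lerXn2r; rewrite ?nnegrE ?expR_ge0 ?(ltW q0)//.
  by apply: le_trans (expR_ge1Dx _); rewrite lerDr.
move=> /(ler_wpM2l (ltW e0)); apply: le_trans.
have -> : (a * x / k.+1%:R) ^+ k.+1 = x ^+ k * x / c.
  rewrite -exprSr /c !exprMn !exprVn; field.
  by rewrite !expf_neq0 ?gt_eqF.
rewrite [leRHS](_ : _ = x ^+ k * (x * e / c)); last by ring.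
rewrite ler_peMr ?exprn_ge0 ?(ltW x0)// ler_pdivlMr// mul1r.
by rewrite -ler_pdivrMr.
Unshelve. all: by end_near. Qed.

(** Integration by parts on a half-line, carried out on antiderivatives so that
    the fundamental theorem of calculus is applied only once. *)
Lemma gamma_antiderivative k a : 0 < a -> exists F : R -> R,
  [/\ forall x, is_derive x 1 F (x ^+ k * expR (- (a * x))),
      F 0 = - (k`!%:R / a ^+ k.+1) &
      F x @[x --> +oo] --> 0].
Proof.
move=> a0; have a1 : a != 0 by rewrite gt_eqF.
have dE x : is_derive x 1 (fun y => expR (- (a * y))) (- a * expR (- (a * x))).
  have dl : is_derive x 1 (fun y : R => - (a * y)) (- a).
    by apply: is_derive_eq; rewrite /GRing.scale/=; ring.
  have := is_derive1_comp (g := fun y => - (a * y)) (is_derive_expR _) dl.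
  by rewrite mulrC.
elim: k => [|k [F [dF F0 Foo]]].
  exists (fun x => - a^-1 * expR (- (a * x))); split.
  - by move=> x; apply: is_derive_eq; rewrite /GRing.scale/= expr0; field.
  - by rewrite mulr0 oppr0 expR0 fact0 expr1; field.
  - rewrite -[X in _ --> X](mulr0 (- a^-1)); apply: cvgMl_tmp.
    have := cvg_exprn_expRN 0 a0.
    by under eq_cvg do rewrite expr0 mul1r.
exists (fun x => a^-1 * (k.+1%:R * F x - x ^+ k.+1 * expR (- (a * x)))); split.
- move=> x.
  have dX : is_derive x 1 (fun y : R => y ^+ k.+1) (k.+1%:R * x ^+ k).
    apply: DeriveDef; rewrite ?exp_derive/= ?/GRing.scale/= ?mulr1//.
    exact: exprn_derivable.
  by apply: is_derive_eq; rewrite /GRing.scale/=; field.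
- rewrite F0 expr0n/= mul0r subr0 factS natrM [a ^+ k.+2]exprS; field.
  by rewrite expf_neq0// a1.
- rewrite (_ : 0 = a^-1 * (k.+1%:R * 0 - 0)); last by rewrite mulr0 subr0 mulr0.
  by apply: cvgMl_tmp; apply: cvgB; [exact: cvgMl_tmp|exact: cvg_exprn_expRN].
Qed.

Let cont_gamma k a : continuous (fun x : R => x ^+ k * expR (- (a * x))).
Proof.
move=> x; apply: cvgM; first exact: exprn_continuous.
apply: (@continuous_comp _ _ _ (fun y : R => - (a * y)) expR).
  by apply: cvgN; apply: cvgMl_tmp; exact: cvg_id.
exact: continuous_expR.
Qed.

Lemma integral_gamma k a : 0 < a ->
  (\int[lebesgue_measure]_(x in [set x : R | (0 < x)%R])
     (x ^+ k * expR (- (a * x)))%:E = (k`!%:R / a ^+ k.+1)%:E)%E.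
Proof.
move=> a0; have [F [dF F0 Foo]] := gamma_antiderivative k a0.
have dF1 x : derivable F x 1 by exact: (@ex_derive _ _ _ _ _ _ _ (dF x)).
have -> : [set x : R | 0 < x] = `]0, +oo[%classic.
  by apply/seteqP; split => x /=; rewrite in_itv/= andbT.
rewrite integral_itv_obnd_cbnd; last first.
  apply/measurable_EFinP; apply: measurable_funTS.
  exact: continuous_measurable_fun.
rewrite (@ge0_continuous_FTC2y _ _ F _ 0)//.
- by rewrite F0 sub0e -EFinN opprK.
- by move=> x x0; rewrite mulr_ge0 ?exprn_ge0 ?expR_ge0.
- exact: continuous_subspaceT.
- apply: cvg_at_right_filter.
  exact/differentiable_continuous/derivable1_diffP.
- by move=> x _; rewrite derive1E (@derive_val _ _ _ _ _ _ _ (dF x)).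
Qed.

Lemma Rintegral_gammaZ k a c : 0 < a -> 0 <= c ->
  \int[lebesgue_measure]_(x in [set x : R | 0 < x])
    (c * (x ^+ k * expR (- (a * x)))) = c * (k`!%:R / a ^+ k.+1).
Proof.
move=> a0 c0; rewrite /Rintegral.
under eq_integral do rewrite EFinM.
rewrite ge0_integralZl_EFin ?integral_gamma//.
- have -> : [set x : R | 0 < x] = `]0, +oo[%classic; last exact: measurable_itv.
  by apply/seteqP; split => x /=; rewrite in_itv/= andbT.
- by move=> x /= x0; rewrite lee_fin mulr_ge0 ?exprn_ge0 ?expR_ge0// ltW.
- apply/measurable_EFinP; apply: measurable_funTS.
  exact: continuous_measurable_fun.
Qed.

(** In the variable [t = a x / k] the kernel is a multiple of
    [(t * exp (- t)) ^ k], and [t < exp (t - 1)] unless [t = 1]. *)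
Lemma gamma_kernel_max k a x : (0 < k)%N -> 0 < a -> 0 < x ->
  x != k%:R / a ->
  x ^+ k * expR (- (a * x)) <
  (k%:R / a) ^+ k * expR (- (a * (k%:R / a))).
Proof.
move=> k0 a0 x0 xk.
have kR : 0 < k%:R :> R by rewrite ltr0n.
pose t := a * x / k%:R.
have t0 : 0 < t by rewrite divr_gt0 ?mulr_gt0.
have xE : x = k%:R / a * t by rewrite /t; field; rewrite !gt_eqF.
have t1 : t - 1 != 0.
  rewrite subr_eq0; apply: contra xk => /eqP tE.
  by apply/eqP; rewrite [LHS]xE tE mulr1.
have -> : a * x = t * k%:R by rewrite /t; field; rewrite !gt_eqF.
have -> : a * (k%:R / a) = 1 * k%:R by field; rewrite gt_eqF.
clearbody t; rewrite {1}xE exprMn -mulrA ltr_pM2l ?exprn_gt0 ?divr_gt0//.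
rewrite -!mulNr !expRM_natr -exprMn ltrXn2r ?gtn_eqF//.
rewrite ?nnegrE ?mulr_ge0 ?expR_ge0 ?(ltW t0)//.
have := expR_gt1Dx t1; rewrite addrC subrK expRD => tlt.
rewrite expRN ltr_pdivrMr ?expR_gt0//.
by rewrite mulrC.
Qed.

End gamma_integral.

(** * The exact Laplace ratio *)

Section laplace_ratio.
Context (R : realType) (n : nat).
Variables (y : 'I_n -> nat) (theta : R).
Hypothesis theta0 : 0 < theta.
Let k := (\sum_(i < n) y i)%N.
Let a : R := 1 + n%:R * theta.
Let C : R := theta ^+ k / \prod_(i < n) (y i)`!%:R.

Let a0 : 0 < a.
Proof. by rewrite ltr_pwDl// mulr_ge0// ltW. Qed.

Let C0 : 0 < C.
Proof. by rewrite divr_gt0 ?exprn_gt0// prodr_gt0. Qed.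

Lemma joint_densityE omega :
  joint_density y theta omega = C * (omega ^+ k * expR (- (a * omega))).
Proof.
rewrite /joint_density !big_split/= prodfV -expr_sum -/k prodr_const.
rewrite card_ord exprMn -expRM_natr mulrACA.
have -> : - (a * omega) = - omega + - (omega * theta) * n%:R.
  by rewrite /a; ring.
rewrite expRD /C; ring.
Qed.

Hypothesis k0 : (0 < k)%N.
Let kR : 0 < k%:R :> R.
Proof. by rewrite ltr0n. Qed.

Lemma omega_hatE : omega_hat y theta = k%:R / a.
Proof.
have max0 x : 0 < x -> x != k%:R / a ->
  joint_density y theta x < joint_density y theta (k%:R / a).
  by move=> x0 xk; rewrite !joint_densityE ltr_pM2l//; exact: gamma_kernel_max.
apply: xget_unique => /=.
  split=> [|x /= x0]; first by rewrite divr_gt0.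
  by have [->//|xk] := eqVneq x (k%:R / a); rewrite ltW// max0.
move=> x [x0 xmax]; apply/eqP; apply: contraT => xk.
have /= := xmax (k%:R / a) (divr_gt0 kR a0).
by rewrite leNgt max0.
Qed.

Lemma hessian_hatE : hessian_hat y theta = a ^+ 2 / k%:R.
Proof.
have o0 : 0 < k%:R / a by rewrite divr_gt0.
rewrite /hessian_hat omega_hatE.
have lnE x : 0 < x ->
    ln (joint_density y theta x) = ln C + (k%:R * ln x - a * x).
  move=> x0; rewrite joint_densityE.
  rewrite lnM ?posrE ?C0 ?mulr_gt0 ?expR_gt0 ?exprn_gt0//.
  rewrite [X in _ + X]lnM ?posrE ?expR_gt0 ?exprn_gt0//.
  by rewrite lnXn// expRK mulr_natl.
have dE x : 0 < x ->
    derive1 (fun omega : R => ln (joint_density y theta omega)) x =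
    k%:R / x - a.
  move=> x0; have dln := is_derive1_ln x0.
  rewrite derive1E.
  have -> : 'D_1 (fun omega : R => ln (joint_density y theta omega)) x =
      'D_1 (fun omega : R => ln C + (k%:R * ln omega - a * omega)) x.
    apply: near_eq_derive; near=> z; rewrite lnE//.
    by near: z; exact: lt_nbhsr.
  have d1 : is_derive x 1
      (fun omega : R => ln C + (k%:R * ln omega - a * omega)) (k%:R / x - a).
    by apply: is_derive_eq; rewrite /GRing.scale/=; ring.
  exact: (@derive_val _ _ _ _ _ _ _ d1).
rewrite derive1nS derive1n1 derive1E.
set o := _ / _ in o0 *.
have -> : 'D_1 (derive1 (fun omega : R => ln (joint_density y theta omega))) o =
    'D_1 (fun omega : R => k%:R / omega - a) o.
  apply: near_eq_derive; near=> z; rewrite dE//.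
  by near: z; exact: lt_nbhsr.
have on0 : o != 0 by rewrite gt_eqF.
have dV : is_derive o 1 (fun omega : R => omega^-1) (- o ^- 2).
  apply: (is_derive_eq (is_deriveV (f := id) on0 _)).
  by rewrite /GRing.scale/= mulr1.
have d2 : is_derive o 1 (fun omega : R => k%:R / omega - a) (- (k%:R * o ^- 2)).
  by apply: is_derive_eq; rewrite /GRing.scale/=; ring.
rewrite (@derive_val _ _ _ _ _ _ _ d2) opprK /o; field.
by rewrite !gt_eqF.
Unshelve. all: by end_near. Qed.

(** The ratio depends on the data only through the sum [k], and not at all on
    [theta]: the factors [a ^ - (k + 1)] cancel, one power of [a] coming from
    the square root of the curvature. *)
Lemma laplace_ratioE :
  marginal_likelihood y theta / laplace_marginal y theta =
  k`!%:R / (Num.sqrt (2 * pi) * Num.sqrt k%:R * k%:R ^+ k * expR (- k%:R)).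
Proof.
have mE : marginal_likelihood y theta = C * (k`!%:R / a ^+ k.+1).
  rewrite /marginal_likelihood -(Rintegral_gammaZ k a0 (ltW C0)).
  by apply: eq_Rintegral => x _; rewrite joint_densityE.
rewrite mE /laplace_marginal hessian_hatE omega_hatE joint_densityE.
have -> : Num.sqrt (a ^+ 2 / k%:R) = a / Num.sqrt k%:R.
  by rewrite sqrtrM ?sqr_ge0// sqrtr_sqr gtr0_norm// sqrtrV// ltW.
have -> : a * (k%:R / a) = k%:R by field; rewrite gt_eqF.
have : 0 < Num.sqrt k%:R :> R by rewrite sqrtr_gt0.
have : 0 < Num.sqrt (2 * pi) :> R by rewrite sqrtr_gt0 mulr_gt0// pi_gt0.
have : 0 < expR (- k%:R) :> R by exact: expR_gt0.
move: (Num.sqrt (2 * pi)) (Num.sqrt k%:R) (expR (- k%:R)) => p s e e0 p0 s0.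
rewrite [(k%:R / a) ^+ k]exprMn exprVn [a ^+ k.+1]exprS.
have : 0 < a ^+ k by rewrite exprn_gt0.
have : 0 < k%:R ^+ k :> R by rewrite exprn_gt0.
move: (a ^+ k) (k%:R ^+ k) => ak kk kk0 ak0.
clearbody C a; field.
by rewrite !gt_eqF.
Qed.

End laplace_ratio.

(** * Poisson masses *)

Section poisson_mass.
Context {R : realType}.
Implicit Types (r s : R) (k n : nat).

(** Unlike [poisson_pmf], this is the mass function of the Dirac measure at [0]
    when the rate is [0], so that it describes the empty sum. *)
Definition poisson_mass r k : R := r ^+ k / k`!%:R * expR (- r).

Lemma poisson_mass0 k : poisson_mass 0 k = (k == 0%N)%:R.
Proof.
rewrite /poisson_mass oppr0 expR0 mulr1 expr0n.
by case: k => [|k]; rewrite ?fact0 ?divr1// mul0r.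
Qed.

Lemma poisson_massD r s k :
  \sum_(j < k.+1) poisson_mass r j * poisson_mass s (k - j) =
  poisson_mass (r + s) k.
Proof.
rewrite /poisson_mass [r + s]addrC exprDn opprD expRD !mulr_suml.
apply: eq_bigr => j _.
have jk : (j <= k)%N by rewrite -ltnS.
have <- := bin_fact jk.
have b0 : 'C(k, j)%:R != 0 :> R by rewrite pnatr_eq0 -lt0n bin_gt0.
rewrite !natrM -[_ *+ 'C(k, j)]mulr_natr; field.
by rewrite b0 !pnatr_eq0 -!lt0n !fact_gt0.
Qed.

(** Chernoff's method at level [2 r] with exponent [1 / 2]: each mass is
    multiplied by [exp ((k - 2 r) / 2)], which is at least [1], and the
    exponential series is summed. *)
Lemma poisson_mass_tail r n (B : pred nat) : 0 <= r ->
  (forall k, B k -> 2 * r < k%:R) ->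
  \sum_(k < n | B k) poisson_mass r k <= expR (r * (expR 2^-1 - 2)).
Proof.
move=> r0 Bk; pose s : R := expR 2^-1.
have s0 : 0 <= r * s by rewrite mulr_ge0 ?expR_ge0.
apply: (@le_trans _ _ (\sum_(k < n) exp_coeff (r * s) k * expR (- (2 * r)))).
  rewrite big_mkcond/=; apply: ler_sum => k _.
  case: ifPn => [/Bk rk|_]; last by rewrite mulr_ge0 ?expR_ge0 ?exp_coeff_ge0.
  rewrite /exp_coeff/= exprMn /poisson_mass -!mulrA ler_wpM2l ?exprn_ge0//.
  rewrite [leRHS]mulrCA ler_wpM2l ?invr_ge0//.
  by rewrite /s -expRM_natr -expRD ler_expR; lra.
rewrite -mulr_suml.
have -> : expR (r * (expR 2^-1 - 2)) = expR (r * s) * expR (- (2 * r)).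
  by rewrite -expRD; congr expR; rewrite /s; ring.
rewrite ler_wpM2r ?expR_ge0//.
have := @nondecreasing_cvgn_le _ (series (exp_coeff (r * s))) _
  (is_cvg_series_exp_coeff _) n.
rewrite /series/= big_mkord; apply.
apply/nondecreasing_seqP => m; rewrite /series/= big_nat_recr//= lerDl.
exact: exp_coeff_ge0.
Qed.

(** This makes the exponent in [poisson_mass_tail] negative. *)
Lemma expR_half_lt2 : expR 2^-1 < 2 :> R.
Proof.
have : 1 + - 2^-1 < expR (- 2^-1) :> R.
  by rewrite expR_gt1Dx// oppr_eq0 invr_eq0.
rewrite expRN -[ltRHS]mul1r ltr_pdivlMr ?expR_gt0//; lra.
Qed.

End poisson_mass.

(** * Sums of independent Poisson variables *)

Section borel_cantelli_geometric.
Context d (T : measurableType d) (R : realType).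
Variable mu : {measure set T -> \bar R}.

Lemma ae_eventually_not (F : nat -> set T) (q : R) : 0 < q < 1 ->
  (forall n, measurable (F n)) -> (forall n, mu (F n) <= (q ^+ n)%:E)%E ->
  {ae mu, forall w, exists N : nat, forall n, (N < n)%N -> ~ F n w}.
Proof.
move=> /andP[q0 q1] mF Fq.
have lt0 : (\sum_(n <oo) mu (F n) < +oo)%E.
  apply: (@le_lt_trans _ _ ((1 - q)^-1)%:E); last exact: ltry.
  apply: lime_le; first exact: is_cvg_nneseries.
  apply: nearW => m /=; rewrite big_mkord.
  apply: (@le_trans _ _ (\sum_(n < m) (q ^+ n)%:E)%E); first exact: lee_sum.
  rewrite sumEFin lee_fin.
  have := @geometric_le_lim R m 1 q ler01 q0; rewrite gtr0_norm// => /(_ q1).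
  rewrite mul1r; apply: le_trans; rewrite /series/= big_mkord.
  by apply: ler_sum => n _; rewrite mul1r.
have F0 := lim_sup_set_cvg0 mF lt0.
exists (lim_sup_set F); split => //.
  by apply: bigcap_measurable => // k _; apply: bigcup_measurable => j _.
move=> w /= nw N _.
have [n Nn Fn] : exists2 n, (N < n)%N & F n w.
  apply: contrapT => nF; apply: nw; exists N => n Nn Fnw.
  by apply: nF; exists n.
by exists n => //=; exact: ltnW.
Qed.

End borel_cantelli_geometric.

Section poisson_sums.
Context (R : realType) d (T : measurableType d) (P : probability T R).
Variables (lambda : R) (Y : nat -> {RV P >-> nat}).
Hypothesis lambda0 : 0 < lambda.
Hypothesis iidY : iid_poisson lambda Y.

Definition partial_sum n w := (\sum_(i < n) Y i w)%N.

Lemma iid_poissonE i k : P (Y i @^-1` [set k]) = (poisson_mass lambda k)%:E.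
Proof.
have [_ /(_ i [set k])] := iidY; rewrite /distribution/= /pushforward => ->.
rewrite /poisson_prob lambda0 esum_set1 ?lee_fin ?poisson_pmf_ge0//.
by rewrite /poisson_pmf lambda0.
Qed.

Let cylinder (J : seq nat) (a : nat -> nat) : set T :=
  \bigcap_(i in [set` J]) (Y i @^-1` [set a i]).

Let meas_fiber i k : measurable (Y i @^-1` [set k]).
Proof. exact: measurable_sfunP. Qed.

Let meas_cylinder J a : measurable (cylinder J a).
Proof. by apply: fin_bigcap_measurable => // i _. Qed.

Let partial_sumS n k : [set w | partial_sum n.+1 w = k] =
  \big[setU/set0]_(j < k.+1)
    ([set w | partial_sum n w = j] `&` Y n @^-1` [set (k - j)%N]).
Proof.
rewrite -(bigcup_mkord k.+1
  (fun j => [set w | partial_sum n w = j] `&` Y n @^-1` [set (k - j)%N])).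
apply/seteqP; split => w /=; rewrite /partial_sum big_ord_recr/=.
  move=> <-.
  by exists (\sum_(i < n) Y i w)%N => /=; rewrite ?ltnS ?leq_addr// addKn.
by move=> [j /=]; rewrite ltnS => jk [-> ->]; rewrite subnKC.
Qed.

Lemma measurable_partial_sum n k : measurable [set w | partial_sum n w = k].
Proof.
elim: n k => [|n IHn] k.
  have [->|k0] := eqVneq k 0%N.
    rewrite (_ : [set w | _] = setT)//; apply/seteqP; split => w //= _.
    by rewrite /partial_sum big_ord0.
  rewrite (_ : [set w | _] = set0)//; apply/seteqP; split => w //=.
  by rewrite /partial_sum big_ord0 => kE; rewrite -kE in k0.
rewrite partial_sumS; apply: bigsetU_measurable => j _.
exact: measurableI.
Qed.

(** Independence is a product rule for events on single variables, so
    the independence of a partial sum from the next variables has to be part of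
    the induction: the cylinder over later indices carries it.  In the step, the
    value of the [n]-th variable joins the cylinder. *)
Lemma partial_sum_cylinder n k J a : uniq J -> {in J, forall i, (n <= i)%N} ->
  P ([set w | partial_sum n w = k] `&` cylinder J a) =
  (poisson_mass (n%:R * lambda) k *
   \prod_(i <- J) poisson_mass lambda (a i))%:E.
Proof.
elim: n k J a => [|n IHn] k J a uJ Jn.
  have cylE : P (cylinder J a) = (\prod_(i <- J) poisson_mass lambda (a i))%:E.
    have [indep _] := iidY.
    rewrite indep// -prodEFin; apply: eq_bigr => i _.
    exact: iid_poissonE.
  rewrite mul0r poisson_mass0.
  have [->|k0] := eqVneq k 0%N.
    rewrite mul1r -cylE; congr (P _).
    apply/seteqP; split => w /=; first by case.
    by rewrite /partial_sum big_ord0.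
  rewrite mul0r (_ : _ `&` _ = set0) ?measure0//.
  apply/seteqP; split => w //= [].
  by rewrite /partial_sum big_ord0 => kE; rewrite -kE in k0.
pose F j := [set w | partial_sum n w = j] `&`
  (Y n @^-1` [set (k - j)%N] `&` cylinder J a).
have nJ : n \notin J by apply/negP => /Jn; rewrite ltnn.
have FE j : P (F j) =
    (poisson_mass (n%:R * lambda) j * poisson_mass lambda (k - j) *
     \prod_(i <- J) poisson_mass lambda (a i))%:E.
  pose b i := if i == n then (k - j)%N else a i.
  have bJ i : i \in J -> b i = a i.
    by move=> iJ; rewrite /b ifN//; apply: contraNneq nJ => <-.
  have -> : F j = [set w | partial_sum n w = j] `&` cylinder (n :: J) b.
    congr (_ `&` _); apply/seteqP; split => w /=.
      move=> [wn wJ] i /=; rewrite inE => /predU1P[->|iJ] /=.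
        by rewrite /b eqxx.
      by rewrite bJ//; exact: wJ.
    move=> wJ; split.
      by have := wJ n; rewrite /= inE eqxx /b eqxx; apply.
    by move=> i iJ /=; rewrite -bJ//; apply: wJ; rewrite /= inE iJ orbT.
  rewrite IHn/=.
  - rewrite big_cons {1}/b eqxx -mulrA; congr (_ * (_ * _))%:E.
    by rewrite !big_seq; apply: eq_bigr => i /bJ ->.
  - by rewrite nJ.
  - by move=> i; rewrite inE => /predU1P[->//|/Jn/ltnW].
have -> : [set w | partial_sum n.+1 w = k] `&` cylinder J a =
    \big[setU/set0]_(j < k.+1) F j.
  rewrite partial_sumS big_distrl/=; apply: eq_bigr => j _.
  by rewrite /F setIA.
rewrite measure_bigsetU_ord.
- rewrite (eq_bigr _ (fun (j : 'I_k.+1) _ => FE j)) sumEFin; congr EFin.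
  by rewrite -mulr_suml poisson_massD -natr1 mulrDl mul1r.
- move=> j; apply: measurableI; first exact: measurable_partial_sum.
  exact: measurableI.
- move=> i j _ _ [w [[/= wi _] [/= wj _]]].
  by apply/val_inj; rewrite /= -wi -wj.
Qed.

Lemma partial_sum_poisson n k : P [set w | partial_sum n w = k] =
  (poisson_mass (n%:R * lambda) k)%:E.
Proof.
have := @partial_sum_cylinder n k [::] (fun=> 0%N) isT.
rewrite big_nil mulr1 => <- //; congr (P _).
by apply/seteqP; split => w /=; [|case].
Qed.

Lemma partial_sum_tail n :
  (P [set w | 2 * (n%:R * lambda) < (partial_sum n w)%:R]%R <=
   (expR (lambda * (expR 2^-1 - 2)) ^+ n)%:E)%E.
Proof.
pose B k := 2 * (n%:R * lambda) < k%:R.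
have nl0 : 0 <= n%:R * lambda by rewrite mulr_ge0// ltW.
have -> : [set w | 2 * (n%:R * lambda) < (partial_sum n w)%:R] =
    \bigcup_(k in [set` B]) [set w | partial_sum n w = k].
  apply/seteqP; split => w /=; first by move=> Bw; exists (partial_sum n w).
  by move=> [k Bk /= ->].
rewrite measure_bigcup//=; last 2 first.
  by move=> k _; exact: measurable_partial_sum.
  by move=> i j _ _ [w [/= <- <-]].
apply: lime_le.
  by apply: is_cvg_nneseries => k _ _.
apply: nearW => m /=; rewrite big_mkord.
under eq_bigr do rewrite partial_sum_poisson.
rewrite sumEFin lee_fin -expRM_natr.
have -> : lambda * (expR 2^-1 - 2) * n%:R = n%:R * lambda * (expR 2^-1 - 2).
  by ring.
apply: (@poisson_mass_tail R _ _ (fun k => k \in [set` B])) => // k.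
by rewrite inE.
Qed.

Lemma partial_sum_eventually :
  {ae P, forall w, exists N : nat, forall n, (N < n)%N ->
    (0 < partial_sum n w)%N /\ (partial_sum n w)%:R <= 2 * (n%:R * lambda)}.
Proof.
have mS n (B : set nat) : measurable [set w | B (partial_sum n w)].
  rewrite (_ : mkset _ = \bigcup_(k in B) [set w | partial_sum n w = k]).
    by apply: bigcup_measurable => k _; exact: measurable_partial_sum.
  apply/seteqP; split => w /=; first by move=> Bw; exists (partial_sum n w).
  by move=> [k Bk /= ->].
have upper : {ae P, forall w, exists N : nat, forall n, (N < n)%N ->
    ~ [set w | 2 * (n%:R * lambda) < (partial_sum n w)%:R] w}.
  apply: ae_eventually_not partial_sum_tail.
    rewrite expR_gt0 expR_lt1 pmulr_rlt0// subr_lt0.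
    exact: expR_half_lt2.
  by move=> n; exact: (mS n [set k | 2 * (n%:R * lambda) < k%:R]).
have positive : {ae P, forall w, exists N : nat, forall n, (N < n)%N ->
    ~ [set w | partial_sum n w = 0%N] w}.
  apply: (@ae_eventually_not _ _ _ P _ (expR (- lambda))).
  - by rewrite expR_gt0 expR_lt1 oppr_lt0.
  - by move=> n; exact: measurable_partial_sum.
  - move=> n /=; rewrite partial_sum_poisson /poisson_mass expr0 fact0 divr1.
    by rewrite mul1r -expRM_natr mulNr mulrC.
apply: filterS2 upper positive => w [N1 h1] [N0 h0].
exists (maxn N1 N0) => n; rewrite gtn_max => /andP[n1 n0]; split.
  by rewrite lt0n; apply/eqP; exact: h0.
by rewrite leNgt; apply/negP; exact: h1.
Qed.

End poisson_sums.

(** * The uniform lower bound *)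

Theorem theorem3p7 (R : realType) (d : measure_display)
    (T : measurableType d) (P : probability T R)
    (lambda : R) (Y : nat -> {RV P >-> nat}) :
  0 < lambda ->
  iid_poisson lambda Y ->
  {ae P, forall w, exists N0 : nat, forall n : nat, (N0 < n)%N ->
    inf [set `| marginal_likelihood (fun i : 'I_n => Y i w) theta
                / laplace_marginal (fun i : 'I_n => Y i w) theta - 1 |
        | theta in [set theta : R | 0 < theta]]
      >= 1 / (26 * n%:R * lambda)}.
Proof.
move=> lambda0 iidY.
have [N1 N1E] : exists N : nat, forall n, (N < n)%N -> 1 <= 2 * (n%:R * lambda).
  have l0 : 0 < 2 * lambda by rewrite mulr_gt0.
  exists (Num.bound (2 * lambda)^-1) => n nN.
  rewrite mulrCA -ler_pdivrMr// div1r.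
  have /ltW := archi_boundP (ltW (etrans (invr_gt0 _) l0)).
  by move=> /le_trans; apply; rewrite ler_nat ltnW.
apply: filterS (partial_sum_eventually lambda0 iidY) => w [N SN].
exists (maxn N N1) => n; rewrite gtn_max => /andP[Nn N1n].
have [S0 S2] := SN n Nn; have nl := N1E n N1n.
apply: lb_le_inf.
  by eexists; exists 1 => //=; exact: ltr01.
move=> _ [theta /= theta0 <-].
rewrite laplace_ratioE//.
apply: le_trans (ler_norm _).
rewrite lerBrDl.
apply: le_trans (stirling_ratio_ge S0).
rewrite lerD2l div1r lef_pV2 ?posrE.
- rewrite /partial_sum in S2 *; lra.
- lra.
- by rewrite ltr_pwDr// mulr_ge0.
Qed.
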